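(* Let $m\ge d$. There exist points $\bm x^1,\dots,\bm x^N$ in $\mathbb{S}^d$ and positive weights $w_1,\dots,w_N$ with $w_1+\dots+w_N=1$ and $N\le\dim(\Pi_m)\le(9m/d)^d$ such that $$\int_{\mathbb{S}^d}f(\bm x)\,\mathrm d\mu(\bm x)=\sum_{i=1}^N w_i f(\bm x^i)\quad\text{for all } f\in\Pi_m .$$
   Context: $d,m\in\mathbb{N}=\{1,2,\dots\}$. $\mathbb{S}^d=\{\bm x\in\mathbb{R}^{d+1}:\|\bm x\|=1\}$ is the $d$-dimensional unit sphere and $\mu$ is its normalized surface measure. $\Pi_m$ is the real vector space of restrictions to $\mathbb{S}^d$ of real polynomials of degree at most $m$ in $d+1$ variables, i.e. the span of the functions $\bm x\mapsto x_1^{k_1}\cdots x_{d+1}^{k_{d+1}}$ on $\mathbb{S}^d$ with $\bm k\in\mathbb{N}_0^{d+1}$, $\|\bm k\|_1\le m$. One has $\dim\Pi_m=\binom{m+d}{d}+\binom{m+d-1}{d}$. *)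

(* Defs.v *)
From HB Require Import structures.
From mathcomp Require Import all_boot all_order all_algebra.
From mathcomp Require Import all_classical all_reals all_analysis.
From mathcomp Require Import measurable_realfun.

Set Implicit Arguments.
Unset Strict Implicit.
Unset Printing Implicit Defensive.

Import Order.TTheory GRing.Theory Num.Theory.
Import numFieldNormedType.Exports.

Local Open Scope classical_set_scope.
Local Open Scope ring_scope.

Section lebesgue_tuple_succ.
Context (R : realType) (n : nat).
Variable mu : {sigma_finite_measure set (n.-tuple R) -> \bar R}.

Definition tuple_cons (p : measurableTypeR R * n.-tuple R) : n.+1.-tuple R :=
  [tuple of (p.1 : R) :: p.2].

Lemma measurable_tuple_cons : measurable_fun setT tuple_cons.
Proof.
apply: (@measurable_cons _ _ _ R (fun p => p.1) n snd) => //.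
exact: (@measurable_fst _ _ (measurableTypeR R) (n.-tuple R)).
Qed.

Definition lebesgue_tuple_succ : set (n.+1.-tuple R) -> \bar R :=
  pushforward (lebesgue_measure \x mu)%E tuple_cons.

Let pushforwardM : {measure set (n.+1.-tuple R) -> \bar R} :=
  measure_function_pushforward__canonical__measure_function_Measure
    (lebesgue_measure \x mu)%E measurable_tuple_cons.

Let lebesgue_tuple_succ0 : lebesgue_tuple_succ set0 = 0%E.
Proof. exact: (measure0 pushforwardM). Qed.

Let lebesgue_tuple_succ_ge0 A : (0 <= lebesgue_tuple_succ A)%E.
Proof. exact: (measure_ge0 pushforwardM). Qed.

Let lebesgue_tuple_succ_sigma_additive : semi_sigma_additive lebesgue_tuple_succ.
Proof. exact: (@measure_semi_sigma_additive _ _ _ pushforwardM). Qed.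

HB.instance Definition _ := isMeasure.Build _ _ _ lebesgue_tuple_succ
  lebesgue_tuple_succ0 lebesgue_tuple_succ_ge0
  lebesgue_tuple_succ_sigma_additive.

Let lebesgue_tuple_succ_sigma_finite : sigma_finite setT lebesgue_tuple_succ.
Proof.
have /sigma_finiteP[F [FT ndF Foo]] := sigma_finiteT (@lebesgue_measure R).
have /sigma_finiteP[G [GT ndG Goo]] := sigma_finiteT mu.
pose g (t : n.+1.-tuple R) : measurableTypeR R * n.-tuple R :=
  (thead t, [tuple of behead t]).
have gK : cancel g tuple_cons by move=> t; rewrite /tuple_cons /= -tuple_eta.
have Kg : cancel tuple_cons g.
  by move=> [x t]; rewrite /g /tuple_cons /= theadE; congr pair; exact/val_inj.
have mg : measurable_fun setT g.
  apply/measurable_fun_pairP; split.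
    exact: (@measurable_tnth _ R n.+1 ord0).
  apply/measurable_fun_tnthP => i.
  rewrite (_ : _ \o _ = fun t => tnth t (lift ord0 i)).
    exact: measurable_tnth.
  by apply/funext => t /=; rewrite [in RHS](tuple_eta t) tnthS.
exists (fun k => g @^-1` (F k `*` G k)).
  rewrite -preimage_bigcup -[LHS](preimage_setT g); congr (_ @^-1` _).
  rewrite predeqE => -[x y]; split => // _.
  have [k _ Fkx] : (\bigcup_k F k) x by rewrite -FT.
  have [l _ Gly] : (\bigcup_k G k) y by rewrite -GT.
  exists (maxn k l) => //; split => /=.
    by move: Fkx; exact/subsetPset/ndF/leq_maxl.
  by move: Gly; exact/subsetPset/ndG/leq_maxr.
move=> k; have [mF Fk] := Foo k; have [mG Gk] := Goo k; split.
  rewrite -[X in measurable X]setTI.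
  by apply: mg => //; exact: measurableX.
rewrite /lebesgue_tuple_succ /pushforward -comp_preimage.
rewrite (_ : g \o tuple_cons = id); last by apply/funext => p /=; rewrite Kg.
by rewrite preimage_id product_measure1E// lte_mul_pinfty// ge0_fin_numE.
Qed.

HB.instance Definition _ := Measure_isSigmaFinite.Build _ _ _
  lebesgue_tuple_succ lebesgue_tuple_succ_sigma_finite.
End lebesgue_tuple_succ.

Fixpoint lebesgue_tuple (R : realType) (n : nat) :
    {sigma_finite_measure set (n.-tuple R) -> \bar R} :=
  if n is n'.+1 then lebesgue_tuple_succ (lebesgue_tuple R n')
  else \d_([tuple] : 0.-tuple R).

Lemma lebesgue_tuple_box (R : realType) (n : nat)
    (F : 'I_n -> set (measurableTypeR R)) :
  (forall i, measurable (F i)) ->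
  (lebesgue_tuple R n [set x | forall i, F i (tnth x i)] =
   \prod_(i < n) lebesgue_measure (F i))%E.
Proof.
elim: n F => [|n IHn] F mF.
  rewrite big_ord0 /= diracE mem_set//.
  by move=> [].
rewrite big_ord_recl /= /lebesgue_tuple_succ /pushforward.
rewrite -IHn; last by move=> i; exact: mF.
rewrite -product_measure1E//; last first.
  rewrite (_ : mkset _ = \bigcap_(i in [set: 'I_n])
      ((fun x : n.-tuple R => tnth x i) @^-1` F (lift ord0 i))).
    apply: fin_bigcap_measurable => // i _.
    rewrite -[X in measurable X]setTI.
    by apply: measurable_tnth => //; exact: mF.
  by apply/seteqP; split=> [x Fx i _|x Fx i]; exact: Fx.
congr (_ _); apply/seteqP; split=> [[x y] /= Fxy|[x y] [/= Fx Fy] i].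
  split; first exact: (Fxy ord0).
  by move=> i; have := Fxy (lift ord0 i); rewrite tnthS.
have [->//|i0] := eqVneq i ord0.
by case: (unliftP ord0 i) i0 => [j ->|->]; rewrite ?eqxx// tnthS.
Qed.

Section sphere.
Context (R : realType) (n : nat).
Implicit Types x : n.-tuple R.

(* The library's norm on tuples and matrices is the sup norm. *)
Definition euclidean_norm x : R := Num.sqrt (\sum_(i < n) tnth x i ^+ 2).

Definition unit_sphere : set (n.-tuple R) := [set x | euclidean_norm x = 1].

Definition punctured_ball : set (n.-tuple R) :=
  [set x | 0 < euclidean_norm x <= 1].

Definition tuple_scale (t : R) x : n.-tuple R := [tuple t * tnth x i | i < n].

Definition radial_projection x : n.-tuple R :=
  tuple_scale (euclidean_norm x)^-1 x.

Lemma euclidean_norm_ge0 x : 0 <= euclidean_norm x.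
Proof. exact: sqrtr_ge0. Qed.

Lemma euclidean_normZ t x :
  euclidean_norm (tuple_scale t x) = `|t| * euclidean_norm x.
Proof.
rewrite /euclidean_norm -sqrtr_sqr -sqrtrM ?sqr_ge0//; congr Num.sqrt.
by rewrite mulr_sumr; apply: eq_bigr => i _; rewrite tnth_mktuple exprMn.
Qed.

Lemma radial_projection_sphere x :
  0 < euclidean_norm x -> unit_sphere (radial_projection x).
Proof.
move=> x0; rewrite /unit_sphere /= euclidean_normZ ger0_norm ?invr_ge0 ?ltW//.
by rewrite mulVf// gt_eqF.
Qed.

Lemma measurable_euclidean_norm : measurable_fun setT euclidean_norm.
Proof.
apply: (@measurableT_comp _ _ _ _ _ _ (@Num.sqrt R)).
  apply: continuous_measurable_fun; exact: sqrt_continuous.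
apply: (@measurable_sum _ _ R setT _ _ (fun i x => tnth x i ^+ 2)) => i.
by apply: measurable_funX; exact: measurable_tnth.
Qed.

Lemma measurable_unit_sphere : measurable unit_sphere.
Proof.
rewrite -[unit_sphere]setTI.
exact: (measurable_euclidean_norm measurableT (measurable_set1 (1 : R))).
Qed.

Lemma measurable_punctured_ball : measurable punctured_ball.
Proof.
rewrite (_ : punctured_ball = setT `&` euclidean_norm @^-1` `]0, 1]).
  by apply: measurable_euclidean_norm => //; exact: measurable_itv.
by rewrite setTI; apply/seteqP; split=> x /=; rewrite in_itv.
Qed.

Lemma measurable_radial_projection : measurable_fun setT radial_projection.
Proof.
apply/measurable_fun_tnthP => i.
rewrite (_ : _ \o _ = fun x => (euclidean_norm x) `^ (- 1) * tnth x i).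
  apply: measurable_funM; last exact: measurable_tnth.
  apply: (@measurableT_comp _ _ _ _ _ _ (@powR R ^~ (- 1))).
    exact: measurable_powR.
  exact: measurable_euclidean_norm.
apply/funext => x /=; rewrite tnth_mktuple powR_inv1//.
exact: euclidean_norm_ge0.
Qed.

(* The surface measure of A `<=` unit_sphere is n times the Lebesgue measure of
   the cone {t x | x \in A, 0 < t <= 1} (see surface_measure_cone), i.e. the
   measure given by integration in polar coordinates. *)
Definition surface_measure : set (n.-tuple R) -> \bar R :=
  pushforward
    (mscale n%:R%:nng (mrestr (lebesgue_tuple R n) measurable_punctured_ball))
    radial_projection.

Let pushforwardM : {measure set (n.-tuple R) -> \bar R} :=
  measure_function_pushforward__canonical__measure_function_Measure
    (mscale n%:R%:nng (mrestr (lebesgue_tuple R n) measurable_punctured_ball))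
    measurable_radial_projection.

Let surface_measure0 : surface_measure set0 = 0%E.
Proof. exact: (measure0 pushforwardM). Qed.

Let surface_measure_ge0 A : (0 <= surface_measure A)%E.
Proof. exact: (measure_ge0 pushforwardM). Qed.

Let surface_measure_sigma_additive : semi_sigma_additive surface_measure.
Proof. exact: (@measure_semi_sigma_additive _ _ _ pushforwardM). Qed.

HB.instance Definition _ := isMeasure.Build _ _ _ surface_measure
  surface_measure0 surface_measure_ge0 surface_measure_sigma_additive.

Lemma surface_measure_cone (A : set (n.-tuple R)) : A `<=` unit_sphere ->
  surface_measure A = (n%:R%:E * lebesgue_tuple R n
    [set y | exists (t : R) x,
      [/\ A x, (0 < t)%R, (t <= 1)%R & y = tuple_scale t x]])%E.
Proof.
move=> AS; rewrite /surface_measure /pushforward /mscale /mrestr /=.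
congr (_ * lebesgue_tuple R n _)%E; apply/seteqP; split => y /=.
  move=> [Ay /andP[y0 y1]]; exists (euclidean_norm y), (radial_projection y).
  split=> //; apply: eq_from_tnth => i; rewrite !tnth_mktuple.
  by rewrite mulrA divff ?mul1r// gt_eqF.
move=> [t [x [Ax t0 t1 ->]]].
have x1 : euclidean_norm x = 1 by exact: AS.
rewrite /punctured_ball /= euclidean_normZ x1 mulr1 gtr0_norm// t0 t1.
split=> //; rewrite (_ : radial_projection _ = x)//.
apply: eq_from_tnth => i; rewrite !tnth_mktuple euclidean_normZ x1 mulr1.
by rewrite gtr0_norm// mulrA mulVf ?mul1r// gt_eqF.
Qed.

Lemma surface_measure_sphereT : surface_measure unit_sphere = surface_measure setT.
Proof.
rewrite /surface_measure /pushforward /mscale /mrestr /=.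
congr (_ * lebesgue_tuple R n _)%E; rewrite preimage_setT setTI.
apply/setIidPr => x /andP[x0 _]; exact: radial_projection_sphere.
Qed.

Lemma surface_measure_sphereE :
  surface_measure unit_sphere =
  (n%:R%:E * lebesgue_tuple R n punctured_ball)%E.
Proof.
rewrite surface_measure_sphereT /surface_measure /pushforward /mscale /mrestr /=.
by congr (_ * lebesgue_tuple R n _)%E; rewrite preimage_setT setTI.
Qed.

Let box (D : set (measurableTypeR R)) : set (n.-tuple R) :=
  [set x | forall i, D (tnth x i)].

Let measurable_box D : measurable D -> measurable (box D).
Proof.
move=> mD; rewrite (_ : box D = \bigcap_(i in [set: 'I_n])
    ((fun x : n.-tuple R => tnth x i) @^-1` D)).
  apply: fin_bigcap_measurable => // i _.
  by rewrite -[X in measurable X]setTI; exact: measurable_tnth.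
by apply/seteqP; split=> [x Fx i _|x Fx i]; exact: Fx.
Qed.

Lemma surface_measure_sphere_gt0 : (0 < n)%N ->
  (0 < surface_measure unit_sphere)%E.
Proof.
move=> n0; have n0R : 0 < n%:R :> R by rewrite ltr0n.
rewrite surface_measure_sphereE mule_gt0// ?lte_fin//.
pose D : set (measurableTypeR R) := `]0 : R, n%:R^-1]%classic.
apply: (@lt_le_trans _ _ (lebesgue_tuple R n (box D))).
  rewrite (@lebesgue_tuple_box R n (fun=> D)); last first.
    by move=> _; exact: measurable_itv.
  apply: (@big_ind _ (fun y : \bar R => 0 < y)%E) => //.
    by move=> x y; exact: mule_gt0.
  move=> i _; rewrite lebesgue_measure_itv /= lte_fin invr_gt0 n0R.
  by rewrite oppr0 adde0 lte_fin invr_gt0.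
apply: le_measure; rewrite ?inE.
- by apply: measurable_box; exact: measurable_itv.
- exact: measurable_punctured_ball.
move=> x /= Dx; have {}Dx i : 0 < tnth x i <= n%:R^-1.
  by have := Dx i; rewrite /D /= in_itv.
apply/andP; split.
  rewrite sqrtr_gt0 (bigD1 (Ordinal n0))//=; apply: ltr_wpDr.
    by apply: sumr_ge0 => i _; exact: sqr_ge0.
  by rewrite exprn_gt0//; have /andP[] := Dx (Ordinal n0).
rewrite -[leRHS]sqrtr1; apply: ler_wsqrtr.
apply: (@le_trans _ _ (\sum_(i < n) n%:R^-1)); last first.
  by rewrite sumr_const card_ord -[_ *+ _]mulr_natr mulVf// gt_eqF.
apply: ler_sum => i _; have /andP[x0 xn] := Dx i.
apply: (le_trans _ xn); rewrite expr2 ler_piMl// ?(ltW x0)//.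
by apply: (le_trans xn); rewrite invf_le1// ler1n.
Qed.

Lemma surface_measure_sphere_lty : (surface_measure unit_sphere < +oo)%E.
Proof.
rewrite surface_measure_sphereE.
pose D : set (measurableTypeR R) := `[-1 : R, 1]%classic.
have mD : measurable D by exact: measurable_itv.
apply: lte_mul_pinfty => //; apply: (@le_lt_trans _ _ (lebesgue_tuple R n (box D))).
  apply: le_measure; rewrite ?inE.
  - exact: measurable_punctured_ball.
  - exact: measurable_box.
  move=> x /andP[_ x1] i; rewrite /D /= in_itv /= -ler_norml.
  rewrite -sqrtr_sqr (le_trans _ x1)//; apply: ler_wsqrtr.
  rewrite [leRHS](bigD1 i)//= lerDl; apply: sumr_ge0 => j _; exact: sqr_ge0.
rewrite (@lebesgue_tuple_box R n (fun=> D))//.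
suff : (\prod_(i < n) lebesgue_measure D)%E \is a fin_num.
  by rewrite fin_numElt => /andP[].
apply: (@big_ind _ (fun y : \bar R => y \is a fin_num)) => // [x y|i _].
  exact: fin_numM.
by rewrite lebesgue_measure_itv /=; case: ifP.
Qed.

End sphere.

Arguments unit_sphere R n _ : clear implicits.
Arguments surface_measure R n A : clear implicits.

Section normalized_surface_measure.
Context (R : realType) (d : nat).

Let area : \bar R := surface_measure R d.+1 (unit_sphere R d.+1).

Lemma inv_area_ge0 : 0 <= (fine area)^-1.
Proof. by rewrite invr_ge0; apply/fine_ge0/measure_ge0. Qed.

Definition sphere_measure : set (d.+1.-tuple R) -> \bar R :=
  mscale (NngNum inv_area_ge0) (surface_measure R d.+1).

HB.instance Definition _ := Measure.on sphere_measure.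

Lemma sphere_measureE A :
  sphere_measure A = ((fine area)^-1%:E * surface_measure R d.+1 A)%E.
Proof. by []. Qed.

Lemma sphere_measure_sphere : sphere_measure (unit_sphere R d.+1) = 1%E.
Proof.
rewrite sphere_measureE -/area.
have area0 : (0 < area)%E by exact: surface_measure_sphere_gt0.
have areaoo : (area < +oo)%E := surface_measure_sphere_lty R d.+1.
rewrite -[X in (_ * X)%E]fineK ?ge0_fin_numE ?ltW// -EFinM mulVf//.
by rewrite gt_eqF// fine_gt0// area0.
Qed.

Let sphere_measureT : sphere_measure setT = 1%E.
Proof.
by rewrite -[RHS]sphere_measure_sphere !sphere_measureE surface_measure_sphereT.
Qed.

HB.instance Definition _ :=
  Measure_isProbability.Build _ _ _ sphere_measure sphere_measureT.

End normalized_surface_measure.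

Arguments sphere_measure R d A : clear implicits.

Section dimension.
Context (R : realType) (E : lmodType R).

Definition linear_span (S : set E) : set E :=
  [set v | exists n (c : 'I_n -> R) (s : 'I_n -> E),
     (forall i, S (s i)) /\ v = \sum_(i < n) c i *: s i].

Definition linearly_independent n (b : 'I_n -> E) : Prop :=
  forall c : 'I_n -> R, \sum_(i < n) c i *: b i = 0 -> forall i, c i = 0.

Definition has_dimension (V : set E) (n : nat) : Prop :=
  exists b : 'I_n -> E,
    linearly_independent b /\ V = linear_span (range b).

End dimension.

Section sphere_polynomials.
Context (R : realType) (d : nat).

Definition monomial (k : 'I_d.+1 -> nat) (x : d.+1.-tuple R) : R :=
  \prod_(i < d.+1) tnth x i ^+ k i.

(* A function on the sphere is represented by its extension by 0 to the ambient
   space (f \_ A agrees with f on A and is 0 outside A), so that equality of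
   elements of sphere_polynomials is equality on the sphere. *)
Definition sphere_polynomials (m : nat) : set (d.+1.-tuple R -> R) :=
  linear_span
    [set monomial k \_ (unit_sphere R d.+1)
    | k in [set k : 'I_d.+1 -> nat | (\sum_(i < d.+1) k i <= m)%N]].

End sphere_polynomials.

Arguments sphere_polynomials R d m : clear implicits.

(* Main.v *)
(* Tchakaloff's theorem. On the sphere x_0^2 = 1 - x_1^2 - ... - x_d^2, so the
   monomials of degree at most m in which x_0 has exponent at most 1 span the
   polynomials; there are at most 2 C(d + m, d) of them, which is at most
   (9 m / d)^d because (1 + 1/d)^d <= 4. Let b be a basis of D functions and t
   the vector of their integrals. A convex combination q of points b(x) nearest
   to t exists by compactness, and by minimality the linear form <t - q, .> is
   at most <t - q, q> on every b(x); integrating gives |t - q|^2 <= 0. Conic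
   Caratheodory then reduces the representation of t to D points, and the new
   weights still add up to 1 because 1 is a combination of the basis. *)
Require Import Defs.
From mathcomp Require Import all_boot all_order all_algebra.
From mathcomp Require Import all_classical all_reals all_analysis.
From mathcomp Require Import zify ring lra.

Set Implicit Arguments.
Unset Strict Implicit.
Unset Printing Implicit Defensive.

Import Order.TTheory GRing.Theory Num.Theory.
Import numFieldNormedType.Exports.

Local Open Scope classical_set_scope.
Local Open Scope ring_scope.

(** * Linear spans and the extraction of bases *)

Section linear_span_theory.
Context (R : realType) (E : lmodType R).
Implicit Types (S V : set E) (u v : E).

Lemma mem_linear_span S v : S v -> linear_span S v.
Proof.
by move=> Sv; exists 1%N, (fun=> 1), (fun=> v); split=> //; rewrite big_ord1 scale1r.
Qed.

Lemma linear_span0 S : linear_span S 0.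
Proof. by exists 0%N, (fun=> 0), (fun=> 0); split=> [[]//|]; rewrite big_ord0. Qed.

Lemma linear_spanZ S a v : linear_span S v -> linear_span S (a *: v).
Proof.
move=> [n [c [s [Ss ->]]]]; exists n, (fun i => a * c i), s; split=> //.
by rewrite scaler_sumr; apply: eq_bigr => i _; rewrite scalerA.
Qed.

Lemma linear_spanD S u v :
  linear_span S u -> linear_span S v -> linear_span S (u + v).
Proof.
move=> [n [c [s [Ss ->]]]] [p [c' [s' [Ss' ->]]]]; exists (n + p)%N.
exists (fun i => match fintype.split i with inl j => c j | inr j => c' j end).
exists (fun i => match fintype.split i with inl j => s j | inr j => s' j end).
split; first by move=> i; case: fintype.split.
rewrite big_split_ord; congr (_ + _); apply: eq_bigr => i _.
  by have := unsplitK (inl i : 'I_n + 'I_p) => /= ->.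
by have := unsplitK (inr i : 'I_n + 'I_p) => /= ->.
Qed.

Lemma linear_span_sum S (I : Type) (r : seq I) (P : pred I) (F : I -> E) :
  (forall i, P i -> linear_span S (F i)) ->
  linear_span S (\sum_(i <- r | P i) F i).
Proof.
move=> SF; elim/big_ind: _ => //; [exact: linear_span0 | exact: linear_spanD].
Qed.

Lemma linear_spanS S V : S `<=` linear_span V -> linear_span S `<=` linear_span V.
Proof.
move=> SV _ [n [c [s [Ss ->]]]].
by apply: linear_span_sum => i _; apply: linear_spanZ; exact: SV.
Qed.

(** A combination in [linear_span] may use the same vector several times; choosing an index for each
    term and adding up the coefficients over each index leaves one term per element of [I]. *)
Lemma linear_span_rangeP (I : finType) (b : I -> E) v :
  linear_span (range b) v -> exists c : I -> R, v = \sum_i c i *: b i.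
Proof.
move=> [n [c [s [sb ->]]]].
have {sb}[f fs] : exists f : 'I_n -> I, forall i, b (f i) = s i.
  have [|f fs] := @boolp.choice _ _ (fun i j => b j = s i); last by exists f.
  by move=> i; have [j _ <-] := sb i; exists j.
exists (fun j => \sum_(i | f i == j) c i).
rewrite (partition_big f xpredT)//=; apply: eq_bigr => j _.
by rewrite scaler_suml; apply: eq_bigr => i /eqP <-; rewrite fs.
Qed.

Lemma linear_span_drop n (b : 'I_n.+1 -> E) (c : 'I_n.+1 -> R) i :
  \sum_j c j *: b j = 0 -> c i != 0 ->
  linear_span (range b) = linear_span (range (b \o lift i)).
Proof.
move=> cb0 ci0; apply/seteqP; split; apply: linear_spanS => _ [j _ <-]; last first.
  by apply: mem_linear_span; exists (lift i j).
have mem_lift k : linear_span (range (b \o lift i)) (b (lift i k)).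
  by apply: mem_linear_span; exists k.
have [k ->|->] := unliftP i j; first exact: mem_lift.
have -> : b i = - (c i)^-1 *: \sum_k c (lift i k) *: b (lift i k).
  move: cb0; rewrite (bigD1_ord i)//= => /eqP; rewrite addr_eq0 => /eqP cb.
  by rewrite scaleNr -scalerN -cb scalerA mulVf// scale1r.
by apply/linear_spanZ/linear_span_sum => k _; exact/linear_spanZ/mem_lift.
Qed.

(** A spanning family of least size is independent: a nontrivial relation could be solved for one of
    its vectors, which could then be dropped. *)
Lemma has_dimension_le (I : finType) (g : I -> E) :
  exists2 D, (D <= #|I|)%N & has_dimension (linear_span (range g)) D.
Proof.
set V := linear_span (range g).
pose P n := `[< exists b : 'I_n -> E, V = linear_span (range b) >].
have PI : P #|I|.
  apply/asboolP; exists (g \o enum_val); congr linear_span.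
  apply/seteqP; split=> _ [i _ <-]; last by exists (enum_val i).
  by exists (enum_rank i) => //=; rewrite enum_rankK.
case: (ex_minnP (ex_intro P _ PI)) => D /asboolP[b Vb] Dmin.
exists D; first exact: Dmin.
exists b; split=> // c cb0 i; apply/eqP/negP => /negP ci0.
case: D b Vb Dmin c cb0 i ci0 => [|D] b Vb Dmin c cb0 i ci0; first by case: i ci0.
suff /Dmin : P D by rewrite ltnn.
by apply/asboolP; exists (b \o lift i); rewrite Vb; exact: linear_span_drop ci0.
Qed.

End linear_span_theory.

(** * A numerical bound for binomial coefficients *)

(* From [1 / 2 <= expR (- 1 / 2)], i.e. [expR 1 <= 4]. *)
Lemma succ_expn_le (R : realType) (d : nat) :
  (d.+1%:R ^+ d : R) <= 4 * d%:R ^+ d.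
Proof.
case: d => [|d]; first by rewrite !expr0; lra.
have e4 : expR 1 <= 4 :> R.
  have e2 : expR (2^-1) <= 2 :> R.
    rewrite -[leLHS]invrK -expRN -[leRHS]invrK lef_pV2 ?posrE ?expR_gt0 ?invr_gt0//.
    by apply: le_trans (expR_ge1Dx _); lra.
  rewrite (_ : 1 = 2^-1 * 2%:R); last by field.
  rewrite expRM_natr; have := expR_gt0 (2^-1 : R); nra.
have d0 : 0 < d.+1%:R :> R by rewrite ltr0n.
apply: (@le_trans _ _ (expR 1 * d.+1%:R ^+ d.+1)); last first.
  by rewrite ler_wpM2r// exprn_ge0// ltW.
rewrite -ler_pdivrMr ?exprn_gt0// -expr_div_n.
rewrite [in leRHS](_ : 1 = d.+1%:R^-1 * d.+1%:R); last by rewrite mulVf// gt_eqF.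
rewrite expRM_natr lerXn2r ?nnegrE ?expR_ge0 ?divr_ge0//.
apply: le_trans (expR_ge1Dx _).
by rewrite -natr1 mulrDl divff ?gt_eqF// mul1r.
Qed.

(** Induction on [d]. From [d] to [d + 1] the right side gains the factor [9 * (d + 1)], while the
    left side gains at most [8 * (d + 1)] because $(1 + 1/d)^d \le 4$. *)
Lemma expn_le_fact (R : realType) (d : nat) : (0 < d)%N ->
  2 * (2 * d%:R) ^+ d <= 9 ^+ d * (d`!)%:R :> R.
Proof.
elim: d => // -[_ _|d IH _]; first by rewrite !expr1 (_ : 1`! = 1)%N //; lra.
have := IH isT; have := succ_expn_le R d.+1.
rewrite [(d.+2)`!]factS natrM !exprMn.
set x : R := d.+2%:R; set y : R := d.+1%:R.
rewrite (exprS x d.+1) (exprS 2 d.+1) (exprS 9 d.+1).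
have x0 : 0 <= x by [].
set X := x ^+ d.+1; set Y := y ^+ d.+1; set p := 2 ^+ _; set q := 9 ^+ _; set f := (d.+1)`!%:R.
move=> h1 h2.
have p0 : 0 <= p by rewrite exprn_ge0.
have h : 2 * (2 * p) * X <= 9 * q * f.
  apply: (@le_trans _ _ (2 * (2 * p) * (4 * Y))).
    by rewrite ler_wpM2l// !mulr_ge0.
  have : 0 <= 2 * (p * Y) by rewrite !mulr_ge0// exprn_ge0.
  lra.
by have := ler_wpM2l x0 h; lra.
Qed.

(** The product of ['C(d + m, d)] and [d!] is a falling factorial, at most $(d + m)^d \le (2m)^d$;
    [expn_le_fact] then absorbs $2 \cdot 2^d / d!$ into $(9/d)^d$. *)
Lemma bin_le_expn (R : realType) (d m : nat) : (0 < d)%N -> (d <= m)%N ->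
  (2 * 'C(d + m, d))%:R <= (9 * m%:R / d%:R) ^+ d :> R.
Proof.
move=> d0 dm; have dR : 0 < d%:R :> R by rewrite ltr0n.
have f0 : 0 < (d`!)%:R :> R by rewrite ltr0n fact_gt0.
rewrite expr_div_n ler_pdivlMr ?exprn_gt0// -(ler_pM2r f0).
apply: (@le_trans _ _ (2 * (2 * m%:R) ^+ d * d%:R ^+ d)).
  rewrite mulrAC ler_wpM2r ?exprn_ge0// natrM -mulrA ler_wpM2l//.
  rewrite -!natrM bin_ffact -natrX ler_nat.
  apply: (@leq_trans ((d + m) ^ d)); last by rewrite leq_exp2r//; lia.
  rewrite ffact_prod -[X in (_ <= _ ^ X)%N]card_ord -prod_nat_const.
  by apply: leq_prod => i _; exact: leq_subr.
have := expn_le_fact R d0; rewrite !exprMn.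
have : 0 <= m%:R ^+ d :> R by rewrite exprn_ge0.
set a := 2 ^+ d; set b := m%:R ^+ d; set c := d%:R ^+ d; set e := 9 ^+ d; set f := d`!%:R.
by move=> b_ge0 /(ler_wpM2l b_ge0); lra.
Qed.

(** * Reduction of polynomials modulo the equation of the sphere *)

Section sphere_polynomials_theory.
Context (R : realType) (d : nat).
Implicit Types (x : d.+1.-tuple R) (k : 'I_d.+1 -> nat).

Lemma unit_sphere_sum_sqr x :
  unit_sphere R d.+1 x -> \sum_(i < d.+1) tnth x i ^+ 2 = 1.
Proof.
rewrite /unit_sphere /= /euclidean_norm => x1; rewrite -[RHS](expr1n _ 2) -x1.
by rewrite sqr_sqrtr// sumr_ge0// => i _; exact: sqr_ge0.
Qed.

Lemma monomialD k l x :
  monomial (fun i => k i + l i)%N x = monomial k x * monomial l x.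
Proof. by rewrite -big_split; apply: eq_bigr => i _; rewrite exprD. Qed.

Lemma monomial_delta (j : 'I_d.+1) n x :
  monomial (fun i => (i == j) * n)%N x = tnth x j ^+ n.
Proof.
rewrite /monomial (bigD1 j)//= eqxx mul1n big1 ?mulr1// => i /negbTE ->.
by rewrite mul0n expr0.
Qed.

Lemma monomial_ord0_sqr k x : unit_sphere R d.+1 x ->
  monomial (fun i => k i + (i == ord0) * 2)%N x =
  monomial k x -
  \sum_(j < d) monomial (fun i => k i + (i == lift ord0 j) * 2)%N x.
Proof.
move=> /unit_sphere_sum_sqr; rewrite big_ord_recl => /eqP.
rewrite eq_sym -subr_eq => /eqP x0.
rewrite monomialD monomial_delta -x0 mulrBr mulr1 mulr_sumr; congr (_ - _).
by apply: eq_bigr => j _; rewrite monomialD monomial_delta.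
Qed.

Variable m : nat.

(** The boolean is the exponent of $x_0$ and the tuple holds the other exponents, so that the
    cardinality is a product. *)
Let low_exponents : Type :=
  bool * {t : d.-tuple 'I_m.+1 | t \in [set t : d.-tuple 'I_m.+1 | (\sum_(i <- t) i <= m)%N]%SET}.

Let low_exponent (u : low_exponents) : 'I_d.+1 -> nat :=
  fun i => if unlift ord0 i is Some j then tnth (val u.2) j : nat else u.1 : nat.

(** With exponent 1 at $x_0$ the total degree can reach [m + 1]; such indices are sent to 0. *)
Let low_monomial (u : low_exponents) : d.+1.-tuple R -> R :=
  if (\sum_i low_exponent u i <= m)%N
  then monomial (low_exponent u) \_ (unit_sphere R d.+1) else 0.

(* On the sphere, [x_0 ^ 2] is a polynomial in the other coordinates, so the
   exponent of [x_0] can be taken to be 0 or 1. *)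
Lemma sphere_polynomials_low : exists (I : finType) (g : I -> d.+1.-tuple R -> R),
  #|I| = (2 * 'C(d + m, d))%N /\
  sphere_polynomials R d m = linear_span (range g).
Proof.
exists low_exponents, low_monomial; split.
  by rewrite card_prod card_bool card_sig card_partial_ord_partitions.
apply/seteqP; split; apply: linear_spanS; last first.
  move=> _ [u _ <-]; rewrite /low_monomial; case: ifPn => [um|_].
    by apply: mem_linear_span; exists (low_exponent u).
  exact: linear_span0.
move=> _ [k /= km <-].
(* Induction on a strict bound for the exponent of $x_0$: substituting for $x_0^2$ lowers this
   exponent by 2 and keeps the total degree at most [m]. *)
have [n] := ubnP (k ord0); elim: n => // n IH in k km *; rewrite ltnS => kn.
have [k1|k1] := leqP (k ord0) 1; last first.
  pose k' i := (k i - (i == ord0) * 2)%N.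
  have kE : k = fun i => (k' i + (i == ord0) * 2)%N.
    apply/funext => i; rewrite /k' subnK//.
    by have [->|] := eqVneq i ord0; rewrite ?mul1n ?mul0n.
  have sum_delta j : (\sum_(i < d.+1) (i == j) * 2 = 2)%N.
    by rewrite (bigD1 j)//= eqxx big1// => i /negbTE ->.
  have sumD j : (\sum_i (k' i + (i == j) * 2) = \sum_i k i)%N.
    by rewrite [in RHS]kE !big_split/= !sum_delta.
  have -> : monomial k \_ (unit_sphere R d.+1) =
      monomial k' \_ (unit_sphere R d.+1) + \sum_(j < d) -
        (monomial (fun i => k' i + (i == lift ord0 j) * 2)%N
          \_ (unit_sphere R d.+1) : _ -> R).
    apply/funext => x; rewrite fctE fct_sumE /patch.
    have [xS|xS] := boolP (x \in _); last first.
      rewrite big1 ?addr0// => j _; rewrite fctE (negbTE xS).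
      exact: oppr0.
    rewrite {1}kE monomial_ord0_sqr -?sumrN; last by move: xS; rewrite inE.
    by congr (_ + _); apply: eq_bigr => j _; rewrite fctE xS.
  apply: linear_spanD.
    apply: IH; last by rewrite /k' eqxx; lia.
    by apply: leq_trans km; apply: leq_sum => i _; exact: leq_subr.
  apply: linear_span_sum => j _; rewrite -scaleN1r; apply: linear_spanZ.
  apply: IH; first by rewrite /= sumD.
  by rewrite /k' eqxx /=; lia.
have kj (j : 'I_d) : (k (lift ord0 j) < m.+1)%N.
  by rewrite ltnS (leq_trans _ km)// (bigD1 (lift ord0 j))//= leq_addr.
pose t : d.-tuple 'I_m.+1 := [tuple Ordinal (kj j) | j < d].
have tm : t \in [set t : d.-tuple 'I_m.+1 | (\sum_(i <- t) i <= m)%N]%SET.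
  rewrite inE big_tuple (leq_trans _ km)// big_ord_recl.
  apply: leq_trans (leq_addl _ _); apply: leq_sum => j _.
  by rewrite tnth_mktuple.
have kE : low_exponent (k ord0 == 1%N, Sub t tm) = k.
  apply/funext => i; rewrite /low_exponent.
  have [j ->|->] := unliftP ord0 i; first by rewrite /= tnth_mktuple.
  by move=> /=; case: (k ord0) k1 => [|[]].
apply: mem_linear_span; exists (k ord0 == 1%N, Sub t tm) => //.
by rewrite /low_monomial kE km.
Qed.

End sphere_polynomials_theory.

(** * Caratheodory's theorem for cones *)

Section conic_caratheodory.
Context (R : realType) (T : Type) (K : set T) (n : nat) (phi : T -> 'rV[R]_n).

Definition conic_combination (N : nat) (p : 'rV[R]_n) : Prop :=
  exists (x : 'I_N -> T) (w : 'I_N -> R),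
    [/\ forall i, K (x i), forall i, 0 <= w i & p = \sum_i w i *: phi (x i)].

Lemma conic_combination_drop N (x : 'I_N.+1 -> T) (w : 'I_N.+1 -> R) i :
  (forall i, K (x i)) -> (forall i, 0 <= w i) -> w i = 0 ->
  conic_combination N (\sum_i w i *: phi (x i)).
Proof.
move=> Kx w0 wi0; exists (x \o lift i), (w \o lift i).
split=> [j|j|]; [exact: Kx|exact: w0|].
by rewrite (bigD1_ord i)//= wi0 scale0r add0r.
Qed.

(* Moving the weights along a linear dependency of the [phi (x i)] until the
   first one vanishes. *)
Lemma conic_combination_dep N (x : 'I_N.+1 -> T) (w : 'I_N.+1 -> R)
    (u : 'I_N.+1 -> R) i :
  (forall i, K (x i)) -> (forall i, 0 <= w i) ->
  \sum_i u i *: phi (x i) = 0 -> 0 < u i ->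
  conic_combination N (\sum_i w i *: phi (x i)).
Proof.
move=> Kx w0 ux0 ui0.
(* The least ratio [w j / u j] over positive [u j] is the largest step that keeps all weights
   nonnegative; where [u j <= 0] the weight does not decrease. *)
have [k uk0 kmin] := @Order.TotalTheory.arg_minP _ _ _ i
  (fun j => 0 < u j) (fun j => w j / u j) ui0.
pose w' j := w j - w k / u k * u j.
have -> : \sum_j w j *: phi (x j) = \sum_j w' j *: phi (x j).
  under [RHS]eq_bigr do rewrite scalerBl -scalerA.
  by rewrite sumrB -scaler_sumr ux0 scaler0 subr0.
apply: (conic_combination_drop (i := k)) => // [j|].
  rewrite subr_ge0; have [uj0|uj0] := ltP 0 (u j).
    by rewrite -ler_pdivlMr//; exact: kmin.
  apply: (@le_trans _ _ 0); rewrite ?w0//.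
  by rewrite mulr_ge0_le0// divr_ge0// ltW.
by rewrite /w' divfK ?subrr// gt_eqF.
Qed.

(** In a representation with the fewest terms no weight vanishes, and the vectors [phi (x i)] are
    independent in a space of dimension [n]. *)
Lemma conic_caratheodory N p : conic_combination N p ->
  exists M (x : 'I_M -> T) (w : 'I_M -> R),
    [/\ (M <= n)%N, forall i, K (x i), forall i, 0 < w i
      & p = \sum_i w i *: phi (x i)].
Proof.
move=> Np; pose P M := `[< conic_combination M p >].
have /(ex_intro P)/ex_minnP[M] : P N by exact/asboolP.
move=> /asboolP[x [w [Kx w0 pE]]] Mmin.
have min_contra M' : M = M'.+1 -> ~ conic_combination M' p.
  by move=> MM /asboolP /Mmin; rewrite MM ltnn.
clear Mmin.
exists M, x, w; split=> //; last first.
  move=> i; rewrite lt_neqAle w0 andbT eq_sym; apply/negP => /eqP wi0.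
  case: M => [|M] in x w Kx w0 pE min_contra i wi0 *; first by case: (i).
  apply: (min_contra M) => //; rewrite pE.
  exact: conic_combination_drop wi0.
rewrite leqNgt; apply/negP => nM.
case: M => // M in x w Kx w0 pE nM min_contra *.
(* With more rows than columns, [A] has a nonzero vector in its left kernel, that is, a linear
   dependency of its rows. *)
pose A := \matrix_(i < M.+1) phi (x i).
have : kermx A != 0.
  rewrite kermx_eq0 /row_free; apply: contraL nM => /eqP <-.
  by rewrite -leqNgt rank_leq_col.
move=> /rowV0Pn[u /sub_kermxP uA0 u0].
have {}uA0 : \sum_i u 0 i *: phi (x i) = 0.
  by rewrite -[RHS]uA0 mulmx_sum_row; apply: eq_bigr => i _; rewrite rowK.
have [i ui0] : exists i, u 0 i != 0 by exact/rV0Pn.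
apply: (min_contra M) => //; rewrite pE.
(* The reduction asks for a positive coefficient, so the dependency is negated if need be. *)
have [ui|ui|ui] := ltgtP (u 0 i) 0; last by rewrite ui eqxx in ui0.
  apply: (conic_combination_dep (u := fun i => - u 0 i) (i := i)) => //.
    under eq_bigr do rewrite scaleNr.
    by rewrite sumrN uA0 oppr0.
  by rewrite oppr_gt0.
exact: (conic_combination_dep (u := u 0) (i := i)).
Qed.

End conic_caratheodory.

(** * Caratheodory's theorem for convex hulls *)

Section convex_caratheodory.
Context (R : realType) (T : Type) (K : set T) (n : nat) (phi : T -> 'rV[R]_n).

Definition convex_combination (N : nat) (p : 'rV[R]_n) : Prop :=
  exists (x : 'I_N -> T) (w : 'I_N -> R),
    [/\ forall i, K (x i), forall i, 0 <= w i, \sum_i w i = 1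
      & p = \sum_i w i *: phi (x i)].

Lemma convex_combination_conv N p y s : K y -> 0 <= s <= 1 ->
  convex_combination N p ->
  convex_combination N.+1 ((1 - s) *: p + s *: phi y).
Proof.
move=> Ky /andP[s0 s1] [x [w [Kx w0 w1 ->]]].
exists (fun i => oapp x y (unlift ord0 i)).
exists (fun i => oapp (fun j => (1 - s) * w j) s (unlift ord0 i)).
split=> [i|i||].
- by case: unliftP => [j _|_] //=.
- by case: unliftP => [j _|_] //=; rewrite mulr_ge0 ?subr_ge0.
- rewrite big_ord_recl unlift_none /=.
  under eq_bigr do rewrite liftK /=.
  by rewrite -mulr_sumr w1 mulr1 addrC subrK.
- rewrite big_ord_recl unlift_none /= addrC scaler_sumr; congr (_ + _).
  by apply: eq_bigr => i _; rewrite liftK /= scalerA.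
Qed.

(** Padding: a point of [K] is added repeatedly with weight 0. *)
Lemma convex_combinationS N M p : K !=set0 -> (N <= M)%N ->
  convex_combination N p -> convex_combination M p.
Proof.
move=> [y Ky] /subnK <-; elim: (M - N)%N => // k IH /IH kp.
have := convex_combination_conv (s := 0) Ky _ kp.
by rewrite lexx ler01 subr0 scale1r scale0r addr0; exact.
Qed.

(** Lift [phi] to height 1 in one more dimension. The first coordinate of a conic combination then
    records the sum of its weights, and the conic theorem yields at most [1 + n] terms. *)
Lemma convex_caratheodory N p : K !=set0 ->
  convex_combination N p -> convex_combination n.+1 p.
Proof.
move=> K0 [x [w [Kx w0 w1 pE]]].
pose psi y : 'rV[R]_(1 + n) := row_mx 1 (phi y).
have psiE M (y : 'I_M -> T) (v : 'I_M -> R) :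
    \sum_i v i *: psi (y i) = row_mx (\sum_i v i)%:M (\sum_i v i *: phi (y i)).
  apply/rowP => j; rewrite summxE; have [k ->|k ->] := split_ordP j.
    rewrite ord1 row_mxEl mxE eqxx mulr1n; apply: eq_bigr => i _.
    by rewrite mxE row_mxEl mxE eqxx mulr1.
  rewrite row_mxEr summxE; apply: eq_bigr => i _.
  by rewrite mxE row_mxEr mxE.
have Cpsi : conic_combination K psi N (\sum_i w i *: psi (x i)) by exists x, w.
have [M [y [v [Mn Ky v0]]]] := conic_caratheodory Cpsi.
rewrite !psiE => /eq_row_mx[/(congr1 (fun A : 'M[R]_1 => A 0 0))].
rewrite !mxE !eqxx !mulr1n w1 => v1 vE; apply: (convex_combinationS K0 Mn).
by exists y, v; split=> // [i|]; [exact: ltW|rewrite pE].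
Qed.

End convex_caratheodory.

(** * Nearest points and the half-spaces containing a compact set *)

Lemma mx_coord_continuous (U : ptopologicalType) p q (i : 'I_p) (j : 'I_q) :
  continuous (fun M : 'M[U]_(p, q) => M i j).
Proof.
move=> M s /= Ms; exists (fun k l => if (k == i) && (l == j) then s else setT).
  by move=> k l; case: ifPn => [/andP[/eqP -> /eqP ->]//|_]; exact: filterT.
by move=> N /= /(_ i j); rewrite !eqxx.
Qed.

Section closed_convex_hull.
Context (R : realType) (T : ptopologicalType) (K : set T) (n : nat).
Variable phi : T -> 'rV[R]_n.
Hypotheses (K0 : K !=set0) (cK : compact K).
Hypothesis phi_continuous : forall j, continuous (fun x => phi x 0 j).

Let dist2 (t p : 'rV[R]_n) : R := \sum_j (t 0 j - p 0 j) ^+ 2.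

(** For a fixed number of terms, points and weights range over the compact product of a power of [K]
    with a simplex, and the squared Euclidean distance to [t] depends continuously on them. *)
Lemma nearest_convex_combination t N : (0 < N)%N ->
  exists2 q, convex_combination K phi N q &
    forall p, convex_combination K phi N p -> dist2 t q <= dist2 t p.
Proof.
case: N => // N _.
pose comb (z : 'rV[T]_N.+1 * 'rV[R]_N.+1) : 'rV[R]_n :=
  \sum_i z.2 0 i *: phi (z.1 0 i).
pose W : set 'rV[R]_N.+1 :=
  [set w | forall i, (`[0, 1]%classic : set R) (w 0 i)] `&`
    [set w | \sum_i w 0 i = 1 :> R].
pose A := [set X : 'rV[T]_N.+1 | forall i, K (X 0 i)] `*` W.
have W_compact : compact W.
  have cW : compact [set w : 'rV[R]_N.+1 | forall i, (`[0, 1]%classic : set R) (w 0 i)].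
    have := @rV_compact R N.+1 (fun=> `[0, 1]%classic). by apply=> i; exact: segment_compact.
  apply: (subclosed_compact _ cW); last exact: subIsetl.
  apply: closedI; first exact: compact_closed (@norm_hausdorff _ _) cW.
  apply: (@preimage_closed _ _ (fun w : 'rV[R]_N.+1 => \sum_i w 0 i) [set 1]) => [w _|].
    apply: (continuous_big (@pseudometric_normed_Zmodule.add_continuous R R)) => i _.
    exact: mx_coord_continuous.
  exact: closed_eq.
have A_compact : compact A.
  by apply: compact_setX W_compact; apply: (rV_compact (A := fun=> K)).
have comb_continuous : continuous (dist2 t \o comb).
  apply: (continuous_big (@pseudometric_normed_Zmodule.add_continuous R R)) => j _ z.
  apply: (@continuous_comp _ _ _ (fun z => t 0 j - comb z 0 j) (fun x : R => x ^+ 2)); last first.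
    exact: exprn_continuous.
  apply: continuousB; first exact: cst_continuous.
  have -> : (fun z => comb z 0 j) = fun z => \sum_i z.2 0 i * phi (z.1 0 i) 0 j.
    by apply/funext => y; rewrite summxE; apply: eq_bigr => i _; rewrite mxE.
  move: z; apply: (continuous_big (@pseudometric_normed_Zmodule.add_continuous R R)) => i _ z.
  apply: continuousM.
    apply: (@continuous_comp _ _ _ snd (fun w : 'rV[R]_N.+1 => w 0 i)).
      exact: cvg_snd.
    exact: mx_coord_continuous.
  apply: (@continuous_comp _ _ _ fst (fun X : 'rV[T]_N.+1 => phi (X 0 i) 0 j)).
    exact: cvg_fst.
  apply: (@continuous_comp _ _ _ (fun X : 'rV[T]_N.+1 => X 0 i) (fun x => phi x 0 j)).
    exact: mx_coord_continuous.
  exact: phi_continuous.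
(* One point repeated, with all the weight on the first copy. *)
have A0 : A !=set0.
  have [y Ky] := K0; exists (const_mx y, delta_mx 0 0).
  split => [i|]; first by rewrite mxE.
  split=> [i|] /=.
    by rewrite in_itv /= mxE ler0n lern1 leq_b1.
  rewrite (bigD1 ord0)//= mxE !eqxx big1 ?addr0// => i /negbTE i0.
  by rewrite mxE i0 andbF.
have [z] := compact_EVT_min A0 A_compact (continuous_subspaceT comb_continuous).
rewrite inE => -[Kz [z0 z1]] zmin; exists (comb z).
  exists (z.1 0), (z.2 0); split=> // i.
  by have := z0 i; rewrite /= in_itv /= => /andP[].
move=> _ [x [w [Kx w0 w1 ->]]].
have <- : comb (\row_i x i, \row_i w i) = \sum_i w i *: phi (x i).
  by apply: eq_bigr => i _; rewrite !mxE.
apply: zmin; rewrite inE.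
split=> [i|]; first by rewrite mxE.
split=> [i|] /=; last by rewrite -w1; apply: eq_bigr => i _; rewrite mxE.
rewrite in_itv /= mxE w0 -w1 (bigD1 i)//= lerDl.
by apply: sumr_ge0 => j _.
Qed.

(** If the nearest point [q] differed from [t], the linear form with coefficients [t - q] would
    violate the hypothesis. *)
Lemma closed_convex_hull_compact (t : 'rV[R]_n) :
  (forall (c : 'I_n -> R) e,
    (forall x, K x -> \sum_j c j * phi x 0 j <= e) -> \sum_j c j * t 0 j <= e) ->
  exists N, convex_combination K phi N t.
Proof.
(* Minimize over [n + 2] terms, then rewrite [q] with [n + 1]: this leaves room for one more point,
   so every segment from [q] to some [phi x] consists of competitors. *)
move=> tK; have [q Kq qmin] := nearest_convex_combination t (ltn0Sn n.+1).
have {}Kq := convex_caratheodory K0 Kq.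
suff -> : t = q by exists n.+1.
pose g j := t 0 j - q 0 j.
have gK x : K x -> \sum_j g j * phi x 0 j <= \sum_j g j * q 0 j.
  move=> Kx; rewrite -subr_le0 -sumrB.
  set a := \sum_j _; pose b := \sum_j (phi x 0 j - q 0 j) ^+ 2.
  have b0 : 0 <= b by apply: sumr_ge0 => j _; exact: sqr_ge0.
  (* The change in squared distance when [q] moves by [s] times [phi x - q]. *)
  have ab s : 0 <= s <= 1 -> 0 <= s ^+ 2 * b - 2 * s * a.
    move=> s01; have := qmin _ (convex_combination_conv Kx s01 Kq).
    rewrite -subr_ge0 /dist2 -sumrB => /le_trans; apply.
    rewrite le_eqVlt; apply/orP; left; apply/eqP.
    rewrite !mulr_sumr -sumrB; apply: eq_bigr => j _.
    by rewrite /g !mxE; ring.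
  rewrite leNgt; apply/negP => a0.
  have ab0 : 0 < a + b by lra.
  (* For $s = a/(a+b)$ one has $sb = a - sa$, so the change equals $-sa(1+s) < 0$; this choice also
     covers $b = 0$. *)
  have /ab : 0 <= a / (a + b) <= 1.
    by rewrite ler_pdivrMr // divr_ge0 /=; lra.
  set s := a / (a + b).
  have s0 : 0 < s by rewrite divr_gt0.
  have sE : s * (a + b) = a by rewrite divfK// gt_eqF.
  nra.
(* At [t] the inequality becomes $|t - q|^2 \le 0$. *)
have := tK g _ gK; rewrite -subr_le0 -sumrB => g2.
have g0 : \sum_j (g j) ^+ 2 = 0.
  apply/eqP; rewrite eq_le sumr_ge0 ?andbT; last by move=> j _; exact: sqr_ge0.
  apply: le_trans g2; rewrite le_eqVlt; apply/orP; left; apply/eqP.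
  by apply: eq_bigr => j _; rewrite -mulrBr expr2.
apply/rowP => j; apply/eqP; rewrite -subr_eq0 -sqrf_eq0.
by apply/eqP; apply: (psumr_eq0P _ g0) => // k _; exact: sqr_ge0.
Qed.

End closed_convex_hull.

(** * Integrals of finite linear combinations *)

Lemma RintegralZ_sum d (T : measurableType d) (R : realType)
    (mu : {measure set T -> \bar R}) (S : set T) (I : Type) (r : seq I)
    (c : I -> R) (f : I -> T -> R) :
  measurable S -> (forall i, mu.-integrable S (EFin \o f i)) ->
  mu.-integrable S (EFin \o (fun x => \sum_(i <- r) c i * f i x)) /\
  \int[mu]_(x in S) (\sum_(i <- r) c i * f i x) =
    \sum_(i <- r) c i * \int[mu]_(x in S) f i x.
Proof.
move=> mS fint.
have cfint i : mu.-integrable S (EFin \o (fun x => c i * f i x)).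
  exact: (integrableZl mS (c i) (fint i)).
elim: r => [|i r [int_r IH]].
  split.
    apply: (eq_integrable mS (cst 0%E)) => [x _|]; last exact: integrable0.
    by rewrite /= big_nil.
  under eq_Rintegral do rewrite big_nil.
  by rewrite big_nil /Rintegral integral0.
split.
  apply: (eq_integrable mS _ _ _ (integrableD mS (cfint i) int_r)) => x _.
  by rewrite /= big_cons.
under eq_Rintegral do rewrite big_cons.
by rewrite big_cons RintegralD// IH RintegralZl.
Qed.

(** * Compactness of the sphere and integrability of polynomials on it *)

Section sphere_row_vectors.
Context (R : realType) (d : nat).

(** The measure lives on tuples, while compactness and continuity are stated for row vectors; this
    map links the two. *)
Definition tuple_of_row (X : 'rV[R]_d.+1) : d.+1.-tuple R :=
  [tuple X 0 i | i < d.+1].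

Definition row_sphere : set 'rV[R]_d.+1 :=
  tuple_of_row @^-1` unit_sphere R d.+1.

Lemma tuple_of_row_surj (x : d.+1.-tuple R) :
  tuple_of_row (\row_i tnth x i) = x.
Proof. by apply: eq_from_tnth => i; rewrite tnth_mktuple mxE. Qed.

Lemma row_sphereE : row_sphere = [set X | \sum_i X 0 i ^+ 2 = 1].
Proof.
have sumE X : \sum_i tnth (tuple_of_row X) i ^+ 2 = \sum_i X 0 i ^+ 2.
  by apply: eq_bigr => i _; rewrite tnth_mktuple.
apply/seteqP; split=> X; rewrite /row_sphere /= -sumE; first exact: unit_sphere_sum_sqr.
by rewrite /unit_sphere /= /euclidean_norm => ->; exact: sqrtr1.
Qed.

Lemma row_sphere_neq0 : row_sphere !=set0.
Proof.
exists (delta_mx 0 0); rewrite row_sphereE /= (bigD1 ord0)//= mxE !eqxx expr1n.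
by rewrite big1 ?addr0// => i /negbTE i0; rewrite mxE i0 andbF expr0n.
Qed.

Lemma row_sphere_compact : compact row_sphere.
Proof.
rewrite row_sphereE.
pose B := [set X : 'rV[R]_d.+1 | forall i, (`[-1, 1]%classic : set R) (X 0 i)].
have cB : compact B.
  have := @rV_compact R d.+1 (fun=> `[-1, 1]%classic).
  by apply=> i; exact: segment_compact.
apply: (subclosed_compact _ cB) => [|X /= X1 i].
  apply: (@preimage_closed _ _ (fun X : 'rV[R]_d.+1 => \sum_i X 0 i ^+ 2) [set 1]).
    move=> X _.
    apply: (continuous_big (@pseudometric_normed_Zmodule.add_continuous R R)) => i _ Y.
    apply: (@continuous_comp _ _ _ (fun X : 'rV[R]_d.+1 => X 0 i) (fun x : R => x ^+ 2)).
      exact: mx_coord_continuous.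
    exact: exprn_continuous.
  exact: closed_eq.
rewrite /= in_itv /= -ler_norml -(@expr_le1 _ 2)// real_normK ?num_real// -X1 (bigD1 i)//= lerDl.
by apply: sumr_ge0 => j _; exact: sqr_ge0.
Qed.

Lemma monomial_continuous (k : 'I_d.+1 -> nat) :
  continuous (monomial k \o tuple_of_row).
Proof.
apply: (continuous_big (@mul_continuous R)) => i _.
have -> : (fun X => tnth (tuple_of_row X) i ^+ k i) = (fun X => X 0 i ^+ k i).
  by apply/funext => X; rewrite tnth_mktuple.
move=> Y; apply: (@continuous_comp _ _ _ (fun X : 'rV[R]_d.+1 => X 0 i) (fun x : R => x ^+ k i)).
  exact: mx_coord_continuous.
exact: exprn_continuous.
Qed.

Lemma measurable_monomial (k : 'I_d.+1 -> nat) :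
  measurable_fun setT (@monomial R d k).
Proof.
apply: measurable_prod => i _; apply: measurable_realfun.measurable_funX; exact: measurable_tnth.
Qed.

(** The extension by 0 of a polynomial need not be continuous on the ambient space; [p] is the same
    combination of monomials without the restriction to the sphere. *)
Lemma sphere_polynomials_extend m f : sphere_polynomials R d m f ->
  exists2 p : d.+1.-tuple R -> R, f = p \_ (unit_sphere R d.+1) &
    continuous (p \o tuple_of_row) /\ measurable_fun setT p.
Proof.
move=> [n [c [s [sk ->]]]].
have [k ks] : {k & forall i, s i = monomial (k i) \_ (unit_sphere R d.+1)}.
  apply: (@choice _ _ (fun i k => s i = monomial k \_ (unit_sphere R d.+1))) => i.
  by have [k _ <-] := sk i; exists k.
exists (fun x => \sum_(i < n) c i * monomial (k i) x); last split.
- apply/funext => x; rewrite fct_sumE /patch.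
  have [xS|xS] := boolP (x \in _).
    by apply: eq_bigr => i _; rewrite ks; congr (_ * _); rewrite /patch xS.
  apply: big1 => i _; rewrite ks.
  rewrite -[RHS](mulr0 (c i)); congr (_ * _).
  by rewrite /patch (negbTE xS).
- apply: (continuous_big (@pseudometric_normed_Zmodule.add_continuous R R)) => i _ X.
  apply: continuousM; first exact: cst_continuous.
  exact: (@monomial_continuous (k i)).
- apply: measurable_sum => i; apply: measurable_realfun.measurable_funM; first exact: measurable_cst.
  exact: measurable_monomial.
Qed.

(** A continuous function is bounded on the compact sphere, whose measure is finite. *)
Lemma sphere_polynomials_integrable m f : sphere_polynomials R d m f ->
  (sphere_measure R d).-integrable (unit_sphere R d.+1) (EFin \o f).
Proof.
have mS := @measurable_unit_sphere R d.+1.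
move=> /sphere_polynomials_extend[p -> [cp mp]].
apply: (eq_integrable mS (EFin \o p)) => [x xS|]; first by rewrite /= /patch xS.
apply: measurable_bounded_integrable => //.
- by rewrite (_ : _ (unit_sphere R d.+1) = 1%E) ?ltry//; exact: sphere_measure_sphere.
- exact: measurable_funTS.
- have := compact_bounded (continuous_compact (continuous_subspaceT cp) row_sphere_compact).
  move=> [M [Mr pM]]; exists M; split=> // N MN x Sx.
  apply: (pM N MN); exists (\row_i tnth x i) => /=.
    by rewrite /row_sphere /= tuple_of_row_surj.
  by rewrite tuple_of_row_surj.
Qed.

Lemma sphere_polynomials1 m :
  sphere_polynomials R d m ((cst 1 : _ -> R) \_ (unit_sphere R d.+1)).
Proof.
apply: mem_linear_span; exists (fun=> 0%N); first by rewrite /= big1.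
congr (_ \_ _); apply/funext => x.
by rewrite /monomial big1// => i _; rewrite expr0.
Qed.

End sphere_row_vectors.

Theorem theorem5p6 (R : realType) (d m : nat) (d_gt0 : (0 < d)%N)
    (d_le_m : (d <= m)%N) :
  exists D : nat,
    has_dimension (sphere_polynomials R d m) D /\
    D%:R <= (9 * m%:R / d%:R) ^+ d :> R /\
    exists (N : nat) (x : 'I_N -> d.+1.-tuple R) (w : 'I_N -> R),
      (N <= D)%N /\
      (forall i, unit_sphere R d.+1 (x i)) /\
      (forall i, 0 < w i) /\
      \sum_(i < N) w i = 1 /\
      forall f, sphere_polynomials R d m f ->
        (\int[sphere_measure R d]_(y in unit_sphere R d.+1) (f y)%:E =
         (\sum_(i < N) w i * f (x i))%:E)%E.
Proof.
have mS := @measurable_unit_sphere R d.+1.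
set S := unit_sphere R d.+1 in mS *; set mu := sphere_measure R d.
have [I [g [cardI Vg]]] := sphere_polynomials_low R d m.
have [D DI dimV] := has_dimension_le g.
rewrite cardI in DI; rewrite -Vg in dimV.
exists D; split=> //; split.
  by apply: le_trans (bin_le_expn R d_gt0 d_le_m); rewrite ler_nat.
have [b [_ Vb]] := dimV.
have bV j : sphere_polynomials R d m (b j).
  by rewrite Vb; apply: mem_linear_span; exists j.
have bint j : mu.-integrable S (EFin \o b j) by exact: sphere_polynomials_integrable (bV j).
(* Polynomials [q j] agreeing with [b j] on the sphere make [phi] continuous everywhere. *)
have [q qb] : {q : 'I_D -> d.+1.-tuple R -> R & forall j,
    b j = q j \_ S /\ continuous (q j \o @tuple_of_row R d)}.
  apply: (@choice _ _ (fun j p => b j = p \_ S /\ continuous (p \o @tuple_of_row R d))) => j.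
  by have [p bp [cp _]] := sphere_polynomials_extend (bV j); exists p.
have bq j X : row_sphere X -> q j (tuple_of_row X) = b j (tuple_of_row X).
  by move=> XS; rewrite (qb j).1 /patch mem_set.
pose phi (X : 'rV[R]_d.+1) : 'rV[R]_D := \row_j q j (tuple_of_row X).
pose t : 'rV[R]_D := \row_j \int[mu]_(x in S) b j x.
have phi_continuous j : continuous (fun X => phi X 0 j).
  have -> : (fun X => phi X 0 j) = q j \o @tuple_of_row R d.
    by apply/funext => X; rewrite mxE.
  exact: (qb j).2.
have sum_phi c X : row_sphere X ->
    \sum_j c j * phi X 0 j = \sum_j c j * b j (tuple_of_row X).
  by move=> XS; apply: eq_bigr => j _; rewrite mxE bq.
(* Integrate the pointwise inequality; the constant [e] integrates to itself since the sphere has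
   measure 1. *)
have tK (c : 'I_D -> R) e :
    (forall X, row_sphere X -> \sum_j c j * phi X 0 j <= e) ->
    \sum_j c j * t 0 j <= e.
  move=> ce; under eq_bigr do rewrite mxE.
  have [cint <-] := RintegralZ_sum (index_enum 'I_D) c mS bint.
  have -> : e = \int[mu]_(x in S) e.
    rewrite Rintegral_cst// (_ : _ S = 1%E) ?mulr1//; exact: sphere_measure_sphere.
  apply: le_Rintegral => // [|x Sx].
    exact: (@finite_measure_integrable_cst _ _ _ mu).
  have XS : row_sphere (\row_i tnth x i) by rewrite /row_sphere /= tuple_of_row_surj.
  by have := ce _ XS; rewrite sum_phi// tuple_of_row_surj.
have [N0 [X0 [w0 [X0S w0_ge0 w0_1 tE0]]]] :=
  closed_convex_hull_compact (@row_sphere_neq0 R d) (@row_sphere_compact R d)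
    phi_continuous tK.
(* The conic reduction gives [D] terms where the convex one would give [D + 1]. It forgets the sum
   of the weights, which is recovered below. *)
have Ct : conic_combination (@row_sphere R d) phi N0 t by exists X0, w0.
have [N [X [w [ND XS w_gt0 tE]]]] := conic_caratheodory Ct.
(* Stated for any representation of [t], so that the one with weights [w0] and the one with weights
   [w] can be compared. *)
have quad M (Y : 'I_M -> 'rV[R]_d.+1) (v : 'I_M -> R) (c : 'I_D -> R) :
    (forall i, row_sphere (Y i)) -> t = \sum_i v i *: phi (Y i) ->
    \sum_j c j * t 0 j = \sum_i v i * \sum_j c j * b j (tuple_of_row (Y i)).
  move=> YS ->; under [RHS]eq_bigr do rewrite mulr_sumr.
  rewrite exchange_big; apply: eq_bigr => j _; rewrite summxE mulr_sumr.
  by apply: eq_bigr => i _; rewrite !mxE bq// mulrCA.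
have coord f : sphere_polynomials R d m f ->
    exists c : 'I_D -> R, forall x, f x = \sum_j c j * b j x.
  rewrite Vb => /linear_span_rangeP[c ->]; exists c => x.
  by rewrite fct_sumE.
exists N, (fun i => tuple_of_row (X i)), w; do 4?split=> //.
  (* Expand the constant 1 in the basis: both representations of [t] give it the same value, so [w]
     has the same sum as [w0]. *)
  have [a aE] := coord _ (sphere_polynomials1 R d m).
  have aS Y : row_sphere Y -> \sum_j a j * b j (tuple_of_row Y) = 1.
    by move=> YS; rewrite -aE /patch mem_set.
  have := quad _ _ _ a X0S tE0; rewrite (quad _ _ _ a XS tE).
  under eq_bigr do rewrite aS// mulr1.
  by under [in X in _ = X -> _]eq_bigr do rewrite aS// mulr1; rewrite w0_1.
move=> f fV; rewrite -[LHS]fineK; last first.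
  exact: integrable_fin_num (sphere_polynomials_integrable fV).
congr (_%:E); have [c cE] := coord f fV.
under [RHS]eq_bigr do rewrite cE.
rewrite -(quad _ _ _ c XS tE); under [RHS]eq_bigr do rewrite mxE.
have [_ <-] := RintegralZ_sum (index_enum 'I_D) c mS bint.
by apply: eq_Rintegral => x _; rewrite cE.
Qed.
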